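(* Fix $l\ge 2$, and let $\mathcal{X}=\{x_1,\dots,x_n\}$ and $\mathcal{Y}=\{y_1,\dots,y_n\}$ be two sets of $n$ labeled points in $\mathbb{P}^l$. There exist cameras $A:\mathbb{P}^l\dashrightarrow\mathbb{P}^{l-1}$ and $B:\mathbb{P}^l\dashrightarrow\mathbb{P}^{l-1}$ such that $Ax_i\sim By_i$ for all $i$ if and only if there exist cameras $A':\mathbb{P}^{l+1}\dashrightarrow\mathbb{P}^l$ and $B':\mathbb{P}^{l+1}\dashrightarrow\mathbb{P}^l$ with distinct centers $a',b'$, and a set of labeled points $\mathcal{Z}=\{z_1,\dots,z_n\}\subset\mathbb{P}^{l+1}$, none lying on the line connecting $a'$ and $b'$, such that for all $i$, $x_i\sim A'z_i$ and $y_i\sim B'z_i$.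
   Context: $\mathbb{P}^k$ is $k$-dimensional real projective space; points are represented by nonzero vectors in $\mathbb{R}^{k+1}$, and for nonzero vectors $u\sim v$ means $u=\lambda v$ for some nonzero scalar $\lambda$ (so $Ax_i\sim By_i$ includes that both vectors are nonzero). A camera $\mathbb{P}^{k}\dashrightarrow\mathbb{P}^{k-1}$ ($k\ge2$) is a full rank linear projection, i.e. given by a real $k\times(k+1)$ matrix of rank $k$ (up to scale); its center is the unique point of $\mathbb{P}^k$ spanned by the right nullspace of the matrix. *)

(* Defs.v *)
From HB Require Import structures.
From mathcomp Require Import all_boot all_order all_algebra.
From mathcomp Require Import reals.
Set Implicit Arguments.
Unset Strict Implicit.
Unset Printing Implicit Defensive.
Import Order.TTheory GRing.Theory Num.Theory.
Local Open Scope ring_scope.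

(* R stands for the field of real numbers throughout.  A point of
   P^k is represented by a nonzero column vector of size k.+1; a camera and its
   center are likewise given by representatives. *)

(* Equality of the projective points represented by u and v; both vectors are
   required to be nonzero, so that they do represent points. *)
Definition proj_eq (R : realType) (m : nat) (u v : 'cV[R]_m) : Prop :=
  [/\ u != 0, v != 0 & exists2 c : R, c != 0 & u = c *: v].

Definition is_camera (R : realType) (k : nat) (A : 'M[R]_(k, k.+1)) : Prop :=
  \rank A = k.

(* The right nullspace of A is exactly the line of R^(k+1) spanned by c. *)
Definition is_center (R : realType) (k : nat) (A : 'M[R]_(k, k.+1))
    (c : 'cV[R]_k.+1) : Prop :=
  c != 0 /\ forall v : 'cV[R]_k.+1, A *m v = 0 <-> exists t : R, v = t *: c.

(* Meaningful when a and b represent distinct points. *)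
Definition on_line (R : realType) (m : nat) (a b p : 'cV[R]_m) : Prop :=
  exists s t : R, p = s *: a + t *: b.

(* Main.v *)
Require Import Defs.
From HB Require Import structures.
From mathcomp Require Import all_boot all_order all_algebra.
From mathcomp Require Import reals.
Import Order.TTheory GRing.Theory Num.Theory.
Local Open Scope ring_scope.

Set Implicit Arguments.
Unset Strict Implicit.

(** Both sides say that there is a commuting square of projections
<<
                 A'
       R^(l+2) -----> R^(l+1)
          |              |
       B' |              | A
          v              v
       R^(l+1) -----> R^l
                 B
>>
    through which the two point sets are compatible.

    From [A] and [B], the upper left corner is the fibre product
    [W = {(u, v) | A u = B v}], of dimension [2 (l + 1) - l = l + 2], with its
    two projections.  A relation [A x = c B y] is the point [(x, c y)] of [W].
    The centers of the projections are [(0, b)] and [(a, 0)], with [a] and [b]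
    the centers of [A] and [B]; they are distinct, and they span the kernel of
    the composite map to [R^l], which is nonzero at [(x, c y)].  In the proof,
    [W] has the coordinates [(t, u)], standing for the pair
    [(u, P A u + t b)], where [P] is a right inverse of [B].

    From [A'] and [B'], the lower right corner is the quotient of [R^(l+2)] by
    the line joining the centers, that is, by the span of [a'] and [b'].  The
    quotient map kills both centers, so it factors through [A'] (it is built
    as [A A'] in [quotient_by_baseline]) and through [B'] ([center_factor]).  It does not vanish at [z], which is off that line,
    so the images of [A' z] and [B' z] represent the same point. *)

Lemma camera_of_right_inverse (R : realType) (k : nat) (A : 'M[R]_(k, k.+1))
    (P : 'M[R]_(k.+1, k)) : A *m P = 1%:M -> is_camera A.
Proof.
by move=> AP; apply/eqP; apply/row_freeP; exists P.
Qed.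

Lemma camera_right_inverse (R : realType) (k : nat) (A : 'M[R]_(k, k.+1)) :
  is_camera A -> exists P : 'M[R]_(k.+1, k), A *m P = 1%:M.
Proof. by move=> /eqP; exact: (elimT row_freeP). Qed.

(** A vector of the nullspace is a row vector of the left kernel of [A^T]. *)
Lemma rank_camera_ker (R : realType) (k : nat) (A : 'M[R]_(k, k.+1)) :
  is_camera A -> \rank (kermx A^T) = 1%N.
Proof. by move=> rA; rewrite mxrank_ker mxrank_tr rA subSnn. Qed.

(** The nullspace of a camera is a line, so any nonzero vector of it spans
    it. *)
Lemma camera_center (R : realType) (k : nat) (A : 'M[R]_(k, k.+1))
    (c : 'cV[R]_k.+1) :
  is_camera A -> c != 0 -> A *m c = 0 -> is_center A c.
Proof.
move=> rA c0 Ac; split=> // v; split=> [Av | [t ->]]; last first.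
  by rewrite -scalemxAr Ac scaler0.
have ker (w : 'cV[R]_k.+1) : A *m w = 0 -> (w^T <= kermx A^T)%MS.
  by move=> Aw; apply/sub_kermxP; rewrite -trmx_mul Aw trmx0.
have eq_ker : (c^T == kermx A^T)%MS.
  rewrite -(mxrank_leqif_eq (ker c Ac)) rank_camera_ker // rank_rV.
  by rewrite trmx_eq0 c0.
have /sub_rVP[t vt] : (v^T <= c^T)%MS by rewrite (eqmxP eq_ker) ker.
by exists t; apply: trmx_inj; rewrite linearZ.
Qed.

Lemma camera_has_center (R : realType) (k : nat) (A : 'M[R]_(k, k.+1)) :
  is_camera A -> exists c, is_center A c.
Proof.
move=> rA; exists (nz_row (kermx A^T))^T; apply: camera_center => //.
  by rewrite trmx_eq0 nz_row_eq0 -mxrank_eq0 rank_camera_ker.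
apply: trmx_inj; rewrite trmx_mul trmxK trmx0.
by apply/sub_kermxP; exact: nz_row_sub.
Qed.

(** The rows of such a camera form a basis of the linear forms vanishing at
    [c]. *)
Lemma camera_with_center (R : realType) (k : nat) (c : 'cV[R]_k.+1) :
  c != 0 -> exists2 A : 'M[R]_(k, k.+1), is_camera A & is_center A c.
Proof.
move=> c0.
have rk : \rank (kermx c) = k.
  by rewrite mxrank_ker -mxrank_tr rank_rV trmx_eq0 c0 subn1.
have [A eqA] : exists A : 'M[R]_(k, k.+1), (A :=: kermx c)%MS.
  by move: (row_base _) (eq_row_base (kermx c)); rewrite rk => A; exists A.
have rA : is_camera A by rewrite /is_camera eqA.
exists A => //; apply: camera_center => //.
by apply/sub_kermxP; rewrite eqA.
Qed.

(** The matrix form of the definition of a center: each column of [M] is a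
    multiple of [c], and [r] collects the scalars. *)
Lemma center_ker_mx (R : realType) (k m : nat) (A : 'M[R]_(k, k.+1))
    (c : 'cV[R]_k.+1) (M : 'M[R]_(k.+1, m)) :
  is_center A c -> A *m M = 0 -> exists r : 'rV[R]_m, M = c *m r.
Proof.
move=> [_ kerA] AM.
have /submxP[D MD] : (M^T <= c^T)%MS.
  apply/row_subP => j; rewrite -tr_col.
  have /kerA[t ->] : A *m col j M = 0 by rewrite colE mulmxA AM mul0mx.
  by rewrite linearZ scalemx_sub.
by exists D^T; apply: trmx_inj; rewrite MD trmx_mul trmxK.
Qed.

(** Since [P A - 1] maps into the nullspace of [A], which [C] kills, [C P] is
    the factor of [C] through [A]. *)
Lemma center_factor (R : realType) (k m : nat) (A : 'M[R]_(k, k.+1))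
    (P : 'M[R]_(k.+1, k)) (c : 'cV[R]_k.+1) (C : 'M[R]_(m, k.+1)) :
  A *m P = 1%:M -> is_center A c -> C *m c = 0 -> C *m P *m A = C.
Proof.
move=> AP cA Cc.
have [|r Pr] := @center_ker_mx _ _ _ A c (P *m A - 1%:M) cA.
  by rewrite mulmxBr mulmxA AP mul1mx mulmx1 subrr.
apply/eqP; rewrite -subr_eq0 -mulmxA -{2}[C]mulmx1 -mulmxBr Pr.
by rewrite mulmxA Cc mul0mx.
Qed.

(** The fibre product of [A] and [B] in the coordinates [(t, u)]: the first
    projection forgets [t], and the second one is [(t, u) |-> t b + P A u]. *)
Lemma fibre_product_cameras (R : realType) (l n : nat)
    (x y : 'I_n -> 'cV[R]_l.+1) (A B : 'M[R]_(l, l.+1)) :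
  (forall i, x i != 0) -> (forall i, y i != 0) ->
  is_camera A -> is_camera B ->
  (forall i, proj_eq (A *m x i) (B *m y i)) ->
  exists (A' B' : 'M[R]_(l.+1, l.+2)) (a' b' : 'cV[R]_l.+2)
         (z : 'I_n -> 'cV[R]_l.+2),
    [/\ is_camera A' /\ is_camera B',
        is_center A' a' /\ is_center B' b',
        ~ proj_eq a' b',
        forall i, z i != 0 /\ ~ on_line a' b' (z i) &
        forall i, proj_eq (x i) (A' *m z i) /\ proj_eq (y i) (B' *m z i)].
Proof.
move=> x0 y0 rA rB xy.
have [a [a0 kerA]] := camera_has_center rA.
have [b cB] := camera_has_center rB; have [b0 kerB] := cB.
have [Q AQ] := camera_right_inverse rA.
have [P BP] := camera_right_inverse rB.
have Aa : A *m a = 0 by apply/kerA; exists 1; rewrite scale1r.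
(* [1 + l.+1] and [l.+2] are convertible but not unified by [rewrite], which
   is why block computations are stated at the first form and then applied. *)
have colE0 (t : 'cV[R]_1) (u : 'cV[R]_l.+1) :
    (col_mx t u == 0 :> 'cV[R]_(1 + l.+1)) = (t == 0) && (u == 0).
  exact: col_mx_eq0.
pose A' : 'M[R]_(l.+1, 1 + l.+1) := row_mx 0 1%:M.
pose B' : 'M[R]_(l.+1, 1 + l.+1) := row_mx b (P *m A).
pose a' : 'cV[R]_(1 + l.+1) := col_mx 1%:M 0.
pose b' : 'cV[R]_(1 + l.+1) := col_mx 0 a.
have A'E m (t : 'rV[R]_m) (u : 'M_(_, m)) : A' *m col_mx t u = u.
  by rewrite mul_row_col mul0mx mul1mx add0r.
have B'E m (t : 'rV[R]_m) (u : 'M_(_, m)) :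
    B' *m col_mx t u = b *m t + P *m A *m u.
  exact: mul_row_col.
have lineE (s r : R) : s *: a' + r *: b' = col_mx s%:M (r *: a).
  by rewrite !scale_col_mx add_col_mx !scaler0 addr0 add0r scalemx1.
have rA' : is_camera (A' : 'M[R]_(l.+1, l.+2)).
  apply: (@camera_of_right_inverse _ _ _ (col_mx 0 1%:M : 'M_(1 + l.+1, _))).
  exact: A'E.
have rB' : is_camera (B' : 'M[R]_(l.+1, l.+2)).
  (* To hit [v], take [u = Q B v], which [A] maps to [B v]; the remainder
     [v - P A u = v - P B v] is a multiple of [b], supplied by [t]. *)
  have [|r Er] := @center_ker_mx _ _ _ B b (1%:M - P *m B) cB.
    by rewrite mulmxBr mulmxA BP mul1mx mulmx1 subrr.
  apply: (@camera_of_right_inverse _ _ _ (col_mx r (Q *m B) : 'M_(1 + l.+1, _))).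
  apply: etrans (B'E _ _ _) _.
  by rewrite -Er mulmxA -(mulmxA P) AQ mulmx1 subrK.
have zP i : exists t : 'cV[R]_1, proj_eq (y i) (b *m t + P *m A *m x i).
  have [_ _ [c c0 Ec]] := xy i.
  have [|t Et] := @center_ker_mx _ _ _ B b (c *: y i - P *m A *m x i) cB.
    by rewrite mulmxBr -scalemxAr !mulmxA BP mul1mx Ec subrr.
  exists t; rewrite -Et subrK; split => //.
    by rewrite scaler_eq0 negb_or c0 y0.
  by exists c^-1; rewrite ?invr_eq0 // scalerA mulVf // scale1r.
have [t tP] := fin_all_exists zP.
exists A', B', a', b', (fun i => col_mx (t i) (x i) : 'cV[R]_(1 + l.+1)).
split => //.
- split; apply: camera_center => //.
  + by rewrite colE0 negb_and oner_eq0.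
  + exact: A'E.
  + by rewrite colE0 negb_and a0 orbT.
  + apply: etrans (B'E _ _ _) _; by rewrite mulmx0 add0r -mulmxA Aa mulmx0.
- case=> _ _ [c _ Ea].
  have /eq_col_mx[/eqP] : a' = col_mx 0 (c *: a).
    by have := lineE 0 c; rewrite scale0r add0r -scalemx1 scale0r; apply: etrans.
  by rewrite oner_eq0.
- move=> i; split; first by rewrite colE0 negb_and x0 orbT.
  move=> [s [r Ez]].
  have /eq_col_mx[_ Ex] : col_mx (t i) (x i) = col_mx s%:M (r *: a).
    exact: etrans Ez (lineE s r).
  have [/negP[]] := xy i.
  by rewrite Ex -scalemxAr Aa scaler0.
- move=> i; split; last by rewrite B'E.
  by rewrite A'E; split => //; exists 1; rewrite ?oner_eq0 // scale1r.
Qed.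

(** The quotient by the line joining the centers is [A *m A'], where [A] is a
    projection of [P^l] from the image [A' b'] of the other center. *)
Lemma quotient_by_baseline (R : realType) (k : nat)
    (A' B' : 'M[R]_(k.+1, k.+2)) (a' b' : 'cV[R]_k.+2) :
  is_camera A' -> is_camera B' -> is_center A' a' -> is_center B' b' ->
  ~ proj_eq a' b' ->
  exists A B : 'M[R]_(k, k.+1),
    [/\ is_camera A, is_camera B, A *m A' = B *m B' &
        forall z, A *m A' *m z = 0 -> on_line a' b' z].
Proof.
move=> rA' rB' [a0 kerA'] cB' ab; have [b0 _] := cB'.
have e0 : A' *m b' != 0.
  apply/eqP => /kerA'[t Et]; apply: ab; split => //.
  have t0 : t != 0 by apply: contraNneq b0 => t0; rewrite Et t0 scale0r.
  by exists t^-1; rewrite ?invr_eq0 // Et scalerA mulVf // scale1r.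
have [A rA [_ kerA]] := camera_with_center e0.
have [P A'P] := camera_right_inverse rA'.
have [Q B'Q] := camera_right_inverse rB'.
have [S AS] := camera_right_inverse rA.
have BB' : A *m A' *m Q *m B' = A *m A'.
  apply: (center_factor B'Q cB').
  by rewrite -mulmxA; apply/kerA; exists 1; rewrite scale1r.
exists A, (A *m A' *m Q); split => //.
- apply: (@camera_of_right_inverse _ _ _ (B' *m (P *m S))).
  by rewrite mulmxA BB' -mulmxA (mulmxA A') A'P mul1mx.
- move=> z; rewrite -mulmxA => /kerA[t Et].
  have /kerA'[s Es] : A' *m (z - t *: b') = 0.
    by rewrite mulmxBr -scalemxAr Et subrr.
  by exists s, t; rewrite -Es subrK.
Qed.

Unset Implicit Arguments.
Set Strict Implicit.

Theorem theorem2 (R : realType) (l n : nat) (hl : (2 <= l)%N)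
    (x y : 'I_n -> 'cV[R]_l.+1)
    (hx : forall i, x i != 0) (hy : forall i, y i != 0) :
  (exists A B : 'M[R]_(l, l.+1),
     [/\ is_camera A, is_camera B &
         forall i, proj_eq (A *m x i) (B *m y i)])
  <->
  (exists (A' B' : 'M[R]_(l.+1, l.+2)) (a' b' : 'cV[R]_l.+2)
          (z : 'I_n -> 'cV[R]_l.+2),
     [/\ is_camera A' /\ is_camera B',
         is_center A' a' /\ is_center B' b',
         ~ proj_eq a' b',
         forall i, z i != 0 /\ ~ on_line a' b' (z i) &
         forall i, proj_eq (x i) (A' *m z i) /\ proj_eq (y i) (B' *m z i)]).
Proof.
split=> [[A [B [rA rB xy]]] | ].
  exact: (fibre_product_cameras hx hy rA rB xy).
move=> [A' [B' [a' [b' [z [[rA' rB'] [cA' cB'] ab zP xyP]]]]]].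
have [A [B [rA rB AB kerC]]] :=
  quotient_by_baseline rA' rB' cA' cB' ab.
exists A, B; split=> // i.
have [[_ _ [c c0 ->]] [_ _ [d d0 ->]]] := xyP i.
have Cz : A *m A' *m z i != 0.
  by apply/eqP => /kerC; have [_] := zP i.
rewrite -!scalemxAr !mulmxA -AB; split.
- by rewrite scaler_eq0 negb_or c0.
- by rewrite scaler_eq0 negb_or d0.
- by exists (c / d); rewrite ?mulf_neq0 ?invr_eq0 // scalerA divfK.
Qed.
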